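(* For any $k\ge 2$, any $l\in\mathbb{Q}^k_{>0}$ and any $k$-dimensional lattice $\Lambda\subset\mathbb{Z}^k$, $$\mathrm{gap}(\Lambda,l)\ >\ (k!\,\det(\Lambda)\,l_1\cdots l_k)^{1/k}-\sum_{i=1}^k l_i .$$
   Context: For a $k$-dimensional lattice $\Lambda\subset\mathbb{Z}^k$, $l\in\mathbb{Q}^k_{>0}$ and $r\in\mathbb{Z}^k$, let $m(\Lambda,l,r)=\min\{l\cdot x: x\in\mathbb{Z}^k,\ x-r\in\Lambda,\ x\ge 0\}$ (coordinatewise inequality). The lattice programming gap is $\mathrm{gap}(\Lambda,l)=\max_{r\in\mathbb{Z}^k}m(\Lambda,l,r)$. *)

(* Defs.v *)
From mathcomp Require Import all_boot all_order all_algebra.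
From mathcomp Require Import boolp classical_sets.

Set Implicit Arguments.
Unset Strict Implicit.
Unset Printing Implicit Defensive.

Import Order.TTheory GRing.Theory Num.Theory.
Local Open Scope classical_set_scope.
Local Open Scope ring_scope.

(* Lattices are sets of integer row vectors, and the rows of B are the basis
   vectors.  The basis has as many vectors as the ambient dimension k, so
   nonsingularity is linear independence over the reals. *)
Definition lattice_basis k (Lam : set 'rV[int]_k) (B : 'M[int]_k) : Prop :=
  \det B != 0 /\ Lam = [set z *m B | z in [set: 'rV[int]_k]].

Definition is_lattice k (Lam : set 'rV[int]_k) : Prop :=
  exists B : 'M[int]_k, lattice_basis Lam B.

(* The default value is never used on a lattice: see lattice_detE. *)
Definition lattice_det k (Lam : set 'rV[int]_k) : int :=
  xget 0 [set d | exists2 B : 'M[int]_k, lattice_basis Lam B & d = `|\det B|].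

(* The least and greatest elements of a set of rationals.  The default value 0
   is never used below: see lp_min_attained and lp_gap_attained. *)
Definition set_min (A : set rat) : rat := xget 0 (A `&` lbound A).
Definition set_max (A : set rat) : rat := xget 0 (A `&` ubound A).

Definition dotq k (l : 'rV[rat]_k) (x : 'rV[int]_k) : rat :=
  \sum_i l 0 i * (x 0 i)%:~R.

Definition lp_feasible k (Lam : set 'rV[int]_k) (r : 'rV[int]_k) :
    set 'rV[int]_k :=
  [set x | Lam (x - r) /\ forall i, 0 <= x 0 i].

Definition lp_min k (Lam : set 'rV[int]_k) (l : 'rV[rat]_k)
    (r : 'rV[int]_k) : rat :=
  set_min [set dotq l x | x in lp_feasible Lam r].

Definition lp_gap k (Lam : set 'rV[int]_k) (l : 'rV[rat]_k) : rat :=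
  set_max [set lp_min Lam l r | r in [set: 'rV[int]_k]].

Lemma lattice_detE k (Lam : set 'rV[int]_k) (B : 'M[int]_k) :
  lattice_basis Lam B -> lattice_det Lam = `|\det B|.
Proof.
move=> hB; apply: xget_unique; first by exists B.
move=> _ [B' [dB' eB'] ->]; case: hB => dB eB.
have sub (C D : 'M[int]_k) :
    [set z *m C | z in [set: 'rV_k]] `<=` [set z *m D | z in [set: 'rV_k]] ->
    exists E, C = E *m D.
  move=> CD.
  have /choice[f fP] : forall i, exists z, z *m D = row i C.
    move=> i; have [|z _ zP] := CD (row i C); last by exists z.
    by exists (delta_mx 0 i) => //; rewrite -rowE.
  by exists (\matrix_i f i); apply/row_matrixP => i; rewrite row_mul rowK fP.
have [E eE] : exists E, B' = E *m B by apply: sub; rewrite -eB -eB'.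
have [F eF] : exists F, B = F *m B' by apply: sub; rewrite -eB -eB'.
have := congr1 determinant eF; rewrite {1}eE mulmxA det_mulmx.
rewrite -[LHS]mul1r => /(mulIf dB) /esym; rewrite det_mulmx => FE1.
rewrite eE det_mulmx normrM.
suff -> : `|\det E| = 1 by rewrite mul1r.
have := congr1 absz FE1; rewrite abszM => /eqP.
by rewrite muln_eq1 => /andP[_ /eqP E1]; rewrite -abszE E1.
Qed.

Lemma lattice_sub k (Lam : set 'rV[int]_k) (x y : 'rV[int]_k) :
  is_lattice Lam -> Lam x -> Lam y -> Lam (x - y).
Proof.
move=> [B [_ ->]] [z _ <-] [w _ <-].
by exists (z - w) => //; rewrite mulmxBl.
Qed.

Lemma lattice_multiple k (Lam : set 'rV[int]_k) :
  is_lattice Lam ->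
  exists N : nat, forall z : 'rV[int]_k, Lam (N.+1%:Z *: z).
Proof.
move=> [B [dB ->]]; exists `|\det B|%N.-1 => z.
rewrite prednK ?absz_gt0 // abszE.
exists ((Num.sg (\det B) *: z) *m \adj B) => //.
rewrite -mulmxA mul_adj_mx mul_mx_scalar scalerA mulrC.
by rewrite -normrEsg.
Qed.

Lemma discrete_minimum (A : set rat) (D : nat) : (0 < D)%N -> A !=set0 ->
  (forall v, A v -> exists n : nat, v * D%:R = n%:R) ->
  exists v, (A `&` lbound A) v.
Proof.
move=> D0 [a Aa] AD.
have D0' : 0 < D%:R :> rat by rewrite ltr0n.
have ex : exists n : nat, `[< exists2 v, A v & v * D%:R = n%:R >].
  by have [n e] := AD _ Aa; exists n; apply/asboolP; exists a.
case: (ex_minnP ex) => n /asboolP[v Av vn] nmin.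
exists v; split=> // w Aw; have [p wp] := AD _ Aw.
rewrite -(ler_pM2r D0') vn wp ler_nat; apply: nmin.
by apply/asboolP; exists w.
Qed.

Lemma lp_min_attained k (Lam : set 'rV[int]_k) (l : 'rV[rat]_k)
    (r : 'rV[int]_k) :
  is_lattice Lam -> (forall i, 0 < l 0 i) ->
  let A := [set dotq l x | x in lp_feasible Lam r] in
  A (lp_min Lam l r) /\ lbound A (lp_min Lam l r).
Proof.
move=> hL l0 A; apply: (xgetPex 0 (P := A `&` lbound A)).
apply: (@discrete_minimum _ (\prod_i `|denq (l 0%R i)|)%N).
- by rewrite prodn_gt0 // => i; rewrite absz_gt0 denq_neq0.
- have [N NP] := lattice_multiple hL.
  pose z : 'rV[int]_k := \row_i `|r 0 i|.
  exists (dotq l (r + N.+1%:Z *: z)), (r + N.+1%:Z *: z) => //; split.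
    by rewrite addrC addKr.
  move=> i; rewrite !mxE -lerBlDl sub0r.
  rewrite (le_trans (ler_norm _)) // normrN ler_peMl //.
- move=> _ [x [_ x0] <-].
  suff [m ->] : exists m : nat,
      dotq l x * (\prod_i `|denq (l 0%R i)|)%N%:R = m%:R by exists m.
  rewrite /dotq mulr_suml.
  apply: (big_ind (fun v : rat => exists m : nat, v = m%:R)).
  + by exists 0%N.
  + by move=> _ _ [a ->] [b ->]; exists (a + b)%N; rewrite natrD.
  move=> i _; rewrite (bigD1 i) //= natrM.
  set q := (\prod_(j | _) _)%N.
  exists (`|numq (l 0%R i)| * `|x 0%R i| * q)%N.
  rewrite !natrM mulrA; congr (_ * _).
  have natE (n : int) : 0 <= n -> (`|n|%N)%:R = n%:~R :> rat.
    by move=> n0; rewrite -[in RHS](gez0_abs n0).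
  rewrite !natE ?x0 ?denq_ge0 ?numq_ge0 ?ltW //.
  by rewrite mulrAC numqE.
Qed.

Lemma lp_gap_attained k (Lam : set 'rV[int]_k) (l : 'rV[rat]_k) :
  is_lattice Lam ->
  let A := [set lp_min Lam l r | r in [set: 'rV[int]_k]] in
  A (lp_gap Lam l) /\ ubound A (lp_gap Lam l).
Proof.
move=> hL A; apply: (xgetPex 0 (P := A `&` ubound A)).
have [N NP] := lattice_multiple hL.
have periodic r r' : Lam (r - r') -> lp_min Lam l r = lp_min Lam l r'.
  move=> rr'; rewrite /lp_min; congr (set_min (image _ _)).
  rewrite /lp_feasible; apply/seteqP; split=> x /= [xr x0]; split=> //.
    have L0 : Lam (r' - r).
      by rewrite -opprB -sub0r; apply: lattice_sub => //; rewrite -(subrr (r - r'));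
         apply: lattice_sub.
    have -> : x - r' = (x - r) - (r' - r) by rewrite opprB addrA subrK.
    exact: lattice_sub.
  have -> : x - r = (x - r') - (r - r') by rewrite opprB addrA subrK.
  exact: lattice_sub.
pose rep (f : {ffun 'I_k -> 'I_N.+1}) : 'rV[int]_k := \row_i (f i : nat)%:Z.
pose F f := lp_min Lam l (rep f).
have [f _ fmax] := @arg_maxP _ _ _ [ffun=> ord0] xpredT F isT.
exists (F f); split; first by exists (rep f).
move=> _ [r _ <-].
pose g : {ffun 'I_k -> 'I_N.+1} := [ffun i => inord `|(r 0%R i %% N.+1%:Z)%Z|].
suff -> : lp_min Lam l r = F g by apply: fmax.
apply: periodic.
suff -> : r - rep g = N.+1%:Z *: \row_i (r 0%R i %/ N.+1%:Z)%Z by [].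
apply/rowP => i; rewrite !mxE ffunE inordK; last first.
  by rewrite -ltz_nat gez0_abs ?modz_ge0 // ltz_pmod.
by rewrite gez0_abs ?modz_ge0 // {1}(divz_eq (r 0%R i) N.+1) addrK mulrC.
Qed.

(* Main.v *)
(* Write G for the gap.  Every residue class modulo Lam has a representative in
   the simplex {x >= 0, l.x <= G}, so this simplex has at least det Lam integer
   points.  The unit cubes on these points lie in {x >= 0, l.x <= G + sum l},
   whose volume is (G + sum l)^k / (k! l_1 ... l_k).  This volume comparison is
   carried out discretely, by slicing along the first coordinate: the convexity
   bound n h a^(n-1) <= (a + h)^n - a^n makes the sum over the slices telescope,
   and the last term of the telescope, which is positive as soon as k >= 2, gives
   strictness. *)
Require Import Defs.
From mathcomp Require Import all_boot all_order all_algebra.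
From mathcomp Require Import boolp classical_sets reals exp.
From mathcomp Require Import ring lra.
Import Order.TTheory GRing.Theory Num.Theory.
Local Open Scope classical_set_scope.
Local Open Scope ring_scope.

(** Induction on [n]: multiplying the bound for [n] by [a + h] overshoots the next tangent term by
    exactly [n.+1%:R * h ^+ 2 * a ^+ n]. *)
Lemma exprD_ge_tangent {F : realFieldType} (n : nat) (a h : F) :
  0 <= a -> 0 <= h -> a ^+ n.+1 + n.+1%:R * h * a ^+ n <= (a + h) ^+ n.+1.
Proof.
move=> a0 h0; elim: n => [|n IH]; first by rewrite !expr1 expr0 mul1r mulr1.
rewrite [leRHS]exprSr.
apply: (le_trans _ (ler_wpM2r (addr_ge0 a0 h0) IH)).
rewrite -subr_ge0.
have -> : (a ^+ n.+1 + n.+1%:R * h * a ^+ n) * (a + h)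
    - (a ^+ n.+2 + n.+2%:R * h * a ^+ n.+1) = n.+1%:R * h ^+ 2 * a ^+ n.
  by rewrite !exprS; ring.
by rewrite !mulr_ge0 ?exprn_ge0.
Qed.

(** By the tangent bound at [a = G - h * j%:R + c], slice [j] is at most the drop of the power
    [n.+1] from [a + h] to [a]. The drops telescope down from [h + c + G], and the last [a] is still
    at least [c]. The induction strips slice 0 and restarts from [G - h]. *)
Lemma slice_sum_le {F : realFieldType} (n M : nat) (h c G : F) :
  0 < h -> 0 <= c -> 0 <= G ->
  \sum_(0 <= j < M | h * j%:R <= G) n.+1%:R * h * (G - h * j%:R + c) ^+ n
    <= (h + c + G) ^+ n.+1 - c ^+ n.+1.
Proof.
move=> h0 c0; elim: M G => [|M IH] G G0.
  rewrite big_nil subr_ge0; apply: lerXn2r; rewrite ?nnegrE; lra.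
rewrite big_mkcond big_nat_recl // mulr0 G0 subr0 /=.
have tangent := exprD_ge_tangent n (G + c) h (addr_ge0 G0 c0) (ltW h0).
have -> : h + c + G = G + c + h by ring.
suff tail : \sum_(0 <= j < M) (if h * j.+1%:R <= G
      then n.+1%:R * h * (G - h * j.+1%:R + c) ^+ n else 0)
    <= (G + c) ^+ n.+1 - c ^+ n.+1 by lra.
have shift (j : nat) : h * j.+1%:R = h * j%:R + h by rewrite mulrSr mulrDr mulr1.
have [hG|Gh] := leP h G.
  have := IH (G - h); rewrite subr_ge0 => /(_ hG).
  have -> : h + c + (G - h) = G + c by ring.
  apply: le_trans; rewrite [leRHS]big_mkcond /=; apply: ler_sum => j _.
  by rewrite shift lerBrDr opprD addrA addrAC.
(* For [G < h], slice 0 is the only one. *)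
rewrite big1 => [|j _]; first by rewrite subr_ge0; apply: lerXn2r; rewrite ?nnegrE ?addr_ge0 ?lerDr.
case: ifP => // hjG; have : 0 <= h * j%:R by rewrite mulr_ge0 // ltW.
rewrite shift in hjG; lra.
Qed.

(* The first M slices only: M caps each coordinate and so replaces the floor of
   G / h.  The base case assumes G >= 0. *)
Fixpoint simplex_points (M : nat) (s : seq rat) (G : rat) : seq (seq nat) :=
  if s is h :: s' then
    flatten [seq [seq j :: t | t <- simplex_points M s' (G - h * j%:R)]
            | j <- iota 0 M & h * j%:R <= G]
  else [:: [::]].

Lemma size_simplex_points_cons (M : nat) (h : rat) (s : seq rat) (G : rat) :
  size (simplex_points M (h :: s) G) =
  (\sum_(0 <= j < M | (h * j%:R <= G)%R) size (simplex_points M s (G - h * j%:R)%R))%N.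
Proof.
rewrite /= size_flatten sumnE /shape -map_comp big_map big_filter.
by rewrite /index_iota subn0; apply: eq_bigr => j _; rewrite /= size_map.
Qed.

Lemma mem_simplex_points {I : eqType} (M : nat) (r : seq I) (l : I -> rat)
    (x : I -> nat) (G : rat) :
  (forall i, 0 < l i) -> (forall i, (x i < M)%N) ->
  \sum_(i <- r) l i * (x i)%:R <= G ->
  map x r \in simplex_points M (map l r) G.
Proof.
move=> l0 xM; elim: r G => [//|i r IH] G; rewrite big_cons => lxG /=.
apply/flattenP.
exists [seq x i :: t | t <- simplex_points M (map l r) (G - l i * (x i)%:R)].
  apply: map_f; rewrite mem_filter mem_iota /= xM andbT.
  apply: le_trans lxG; rewrite lerDl; apply: sumr_ge0 => j _.
  by rewrite mulr_ge0 ?ler0n ?ltW.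
by apply: map_f; apply: IH; rewrite lerBrDl.
Qed.

Lemma sumr_ge0_all {F : realFieldType} (s : seq F) :
  all (> 0) s -> 0 <= \sum_(a <- s) a.
Proof. by move=> s0; rewrite big_seq; apply: sumr_ge0 => a /(allP s0) /ltW. Qed.

(** Slice [j] is a simplex of one dimension less with budget [G - h * j%:R]. The slack [c] of
    [slice_sum_le] is the sum of the remaining weights, and the subtracted power is the end of the
    telescope. *)
Lemma size_simplex_points_cons_le (M : nat) (h : rat) (s : seq rat) (G : rat) :
  all (> 0) (h :: s) -> 0 <= G ->
  (size (h :: s))`!%:R * (\prod_(a <- h :: s) a)
      * (size (simplex_points M (h :: s) G))%:R
    <= (\sum_(a <- h :: s) a + G) ^+ (size s).+1
       - (\sum_(a <- s) a) ^+ (size s).+1.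
Proof.
elim: s h G => [|h' s IH] h G; rewrite [all _ _]/= => /andP[h0 s0] G0.
  rewrite size_simplex_points_cons !big_cons !big_nil natr_sum mulr_sumr.
  have := slice_sum_le 0 M h 0 G h0 (lexx _) G0.
  rewrite addr0; apply: le_trans; apply: ler_sum => j _.
  by rewrite expr0 !mulr1.
have sum0 : 0 <= \sum_(a <- h' :: s) a.
  exact: sumr_ge0_all.
have := slice_sum_le (size s).+1 M h _ G h0 sum0 G0.
rewrite size_simplex_points_cons => slices.
rewrite [\sum_(a <- [:: h, _ & _]) a]big_cons.
rewrite [\prod_(a <- [:: h, _ & _]) a]big_cons.
apply: le_trans slices; rewrite natr_sum mulr_sumr; apply: ler_sum => j hjG.
rewrite factS natrM.
set P := \prod_(_ <- _) _; set N := (size _)%:R.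
have -> : (size s).+2%:R * (size s).+1`!%:R * (h * P) * N =
  (size s).+2%:R * h * ((size s).+1`!%:R * P * N) by ring.
rewrite ler_wpM2l ?mulr_ge0 ?(ltW h0) //.
(* Inside a slice the subtracted power is dropped; only the outermost one is kept. *)
have := IH h' (G - h * j%:R) s0; rewrite subr_ge0 => /(_ hjG) /le_trans -> //.
rewrite (addrC (G - _)) gerDl oppr_le0 exprn_ge0 //.
by apply: sumr_ge0_all; have /andP[] := s0.
Qed.

Lemma size_simplex_points_lt (M : nat) (s : seq rat) (G : rat) :
  (1 < size s)%N -> all (> 0) s -> 0 <= G ->
  (size s)`!%:R * (\prod_(a <- s) a) * (size (simplex_points M s G))%:R
    < (\sum_(a <- s) a + G) ^+ size s.
Proof.
case: s => [|h [|h' s]] // _ s0 G0.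
apply: le_lt_trans (size_simplex_points_cons_le M h (h' :: s) G s0 G0) _.
rewrite gtrBl exprn_gt0 // big_cons ltr_wpDr //; have /and3P[_ h'0 s'0] := s0; last exact: h'0.
exact: sumr_ge0_all.
Qed.

(** Smith normal form factors [B] as a diagonal matrix between two unimodular ones, so a change of
    coordinates turns the row lattice into a product of multiples of the [d_i]. *)
Lemma lattice_residues {k : nat} (B : 'M[int]_k) :
  \det B != 0 ->
  exists2 T : finType, #|T| = `|\det B|%N &
  exists f : T -> 'rV[int]_k, forall p q z, f p - f q = z *m B -> p = q.
Proof.
move=> dB0.
have [L Lu [Q Qu [d _ eB]]] := int_Smith_normal_form B.
set D := \matrix_(i, j) _ in eB.
have unit_absz (U : 'M[int]_k) : U \in unitmx -> `|\det U|%N = 1%N.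
  by rewrite unitmxE => /pred2P[] ->.
have detB : `|\det B|%N = (\prod_(i < k) `|(d`_i)%R|)%N.
  rewrite eB !det_mulmx !abszM (unit_absz L) // (unit_absz Q) // mul1n muln1.
  have -> : D = diag_mx (\row_i d`_i).
    by apply/matrixP => i j; rewrite !mxE.
  rewrite det_diag (big_morph _ abszM (erefl _)).
  by apply: eq_bigr => i _; rewrite mxE.
(* The box [0, |d_i|) in the coordinates given by Q meets each residue class once. *)
pose T := {dffun forall i : 'I_k, 'I_(`|(d`_i)%R|%N)}.
exists T.
  rewrite card_dep_ffun foldrE big_image detB.
  by apply: eq_bigr => i _; rewrite card_ord.
exists (fun p : T => (\row_i (p i : nat)%:Z) *m Q) => p q z.
rewrite eB -mulmxBl !mulmxA => /(can_inj (mulmxK Qu)) e.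
apply/ffunP => i; apply/val_inj => /=.
have := congr1 (fun v : 'rV_k => v 0 i) e.
rewrite !mxE (bigD1 i) //= big1 ?addr0 => [|j ji]; last first.
  by rewrite !mxE val_eqE (negbTE ji) mulr0n mulr0.
rewrite !mxE eqxx mulr1n => pq.
have : ((p i : nat)%:Z = (q i : nat)%:Z %[mod d`_i])%Z.
  by apply/eqP; rewrite eqz_mod_dvd pq dvdz_mull.
(* The [d_i] may be negative, while the box is bounded by their absolute values. *)
rewrite -!(modz_abs _ d`_i) !modz_nat => -[].
by rewrite !modn_small.
Qed.

Lemma lp_gap_solution {k : nat} (l : 'rV[rat]_k) (Lam : set 'rV[int]_k)
    (r : 'rV[int]_k) :
  is_lattice Lam -> (forall i, 0 < l 0 i) ->
  exists x : 'rV[int]_k,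
    [/\ Lam (x - r), forall i, 0 <= x 0 i & dotq l x <= lp_gap Lam l].
Proof.
move=> hLam l0; have [_ gap_ub] := lp_gap_attained l hLam.
have [[x [xr x0] lx] _] := lp_min_attained r hLam l0.
by exists x; split=> //; rewrite lx; apply: gap_ub; exists r.
Qed.

Lemma lp_gap_ge0 {k : nat} (l : 'rV[rat]_k) (Lam : set 'rV[int]_k) :
  is_lattice Lam -> (forall i, 0 < l 0 i) -> 0 <= lp_gap Lam l.
Proof.
move=> hLam l0; have [x [_ x0]] := lp_gap_solution l Lam 0 hLam l0.
apply: le_trans; apply: sumr_ge0 => i _.
by rewrite mulr_ge0 ?ler0z ?(ltW (l0 _)).
Qed.

(** This is the theorem raised to the power [k], which stays within the rationals. *)
Lemma lattice_det_lt_gap {k : nat} (l : 'rV[rat]_k) (Lam : set 'rV[int]_k) :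
  (2 <= k)%N -> (forall i, 0 < l 0 i) -> is_lattice Lam ->
  k`!%:R * (lattice_det Lam)%:~R * \prod_(i < k) l 0 i
    < (\sum_(i < k) l 0 i + lp_gap Lam l) ^+ k.
Proof.
move=> k2 l0 hLam; have [B BL] := hLam.
have G0 := lp_gap_ge0 l Lam hLam l0.
rewrite (lattice_detE BL); case: BL => dB0 LamE.
have [T cT [f f_inj]] := lattice_residues B dB0.
have /choice[g gP] := fun p => lp_gap_solution l Lam (f p) hLam l0.
(* Exceeds every coordinate of every chosen point, so the cap loses none of them. *)
pose M := (\sum_p \sum_i `|g p 0%R i|).+1%N.
pose s := [seq l 0 i | i <- enum 'I_k].
pose coords p := [seq `|g p 0%R i|%N | i <- enum 'I_k].
have size_s : size s = k by rewrite size_map size_enum_ord.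
(* If [g p = g q], subtracting the two lattice memberships puts [f p - f q] in [Lam], hence
   [p = q]. *)
have coords_inj : injective coords.
  move=> p q /eq_in_map coord_eq; have gpq : g p = g q.
    apply/rowP => i; have [_ gp0 _] := gP p; have [_ gq0 _] := gP q.
    by rewrite -(gez0_abs (gp0 i)) -(gez0_abs (gq0 i)) coord_eq ?mem_enum.
  have [Lp _ _] := gP p; have [Lq _ _] := gP q.
  have := lattice_sub hLam Lq Lp; rewrite gpq opprB addrC addrA subrK.
  rewrite LamE => -[z _ e]; exact: (f_inj p q z).
have card_le : (`|\det B| <= size (simplex_points M s (lp_gap Lam l)))%N.
  rewrite -cT cardE -(size_map coords); apply: uniq_leq_size.
    by rewrite map_inj_uniq ?enum_uniq.
  move=> _ /mapP[p _ ->]; apply: mem_simplex_points => [//|i|].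
    by rewrite ltnS (bigD1 p) //= (bigD1 i) //= -addnA leq_addr.
  have [_ gp0] := gP p; rewrite /dotq big_enum; apply: le_trans.
  by apply: ler_sum => i _; rewrite natr_absz ger0_norm.
have s0 : all (> 0) s by apply/allP => _ /mapP[i _ ->].
have := size_simplex_points_lt M s (lp_gap Lam l); rewrite size_s => /(_ k2 s0 G0).
rewrite /s !big_map -!enumT !big_enum; apply: le_lt_trans.
rewrite mulrAC ler_wpM2l // ?mulr_ge0 ?prodr_ge0 // => [i _|]; first exact: ltW.
by rewrite -natr_absz ler_nat.
Qed.

Theorem corollary1p1 (R : realType) (k : nat) (hk : (2 <= k)%N)
    (l : 'rV[rat]_k) (hl : forall i : 'I_k, 0 < l 0 i)
    (Lam : set 'rV[int]_k) (hLam : is_lattice Lam) :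
  (k`!%:R * (lattice_det Lam)%:~R * \prod_(i < k) ratr (l 0 i)) `^ (k%:R^-1)
    - \sum_(i < k) ratr (l 0 i)
  < ratr (lp_gap Lam l) :> R.
Proof.
have lt_rat := lattice_det_lt_gap l Lam hk hl hLam.
have G0 := lp_gap_ge0 l Lam hLam hl.
rewrite ltrBlDl.
set S := \sum_(i < k) _; set X := (X in X `^ _).
have S0 : 0 <= S by apply: sumr_ge0 => i _; rewrite ler0q ltW.
have k0 : 0 < k%:R :> R by rewrite ltr0n ltnW.
have SG0 : 0 <= S + ratr (lp_gap Lam l) by rewrite addr_ge0 ?ler0q.
(* The root is strictly increasing on nonnegative reals only. *)
have X0 : 0 <= X.
  have [B BL] := hLam; rewrite /X (lattice_detE BL).
  by rewrite !mulr_ge0 ?ler0z ?prodr_ge0 // => i _; rewrite ler0q ltW.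
have ltX : X < (S + ratr (lp_gap Lam l)) ^+ k.
  move: lt_rat; rewrite -(ltr_rat R) rmorphXn rmorphD !rmorphM !rmorph_sum !rmorph_prod.
  by rewrite /= ratr_nat ratr_int.
have root_SG : ((S + ratr (lp_gap Lam l)) ^+ k) `^ k%:R^-1 = S + ratr (lp_gap Lam l).
  by rewrite -powR_mulrn // -powRrM divff ?lt0r_neq0 // powRr1.
rewrite -[ltRHS]root_SG.
by apply: gt0_ltr_powR; rewrite ?invr_gt0 // nnegrE exprn_ge0.
Qed.
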